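(* Let $\Phi=\phi_1\wedge\cdots\wedge\phi_m$ with $\Pr_{\mathcal D}(\Phi)>0$, and let $\sim$ be a dependency relation for $\Phi$ satisfying Axioms 1 and 2. Then Algorithm $\mathrm{PRS}_f(\Phi,\mathcal D)$ with limited nondeterminism terminates with probability $1$, for any choice function $f$. On termination, $\mathbf X$ is distributed according to $\mathcal D_\Phi$, the distribution $\mathcal D$ conditioned on $\Phi(\mathbf X)$.
   Context: Setting: For $i\in[n]$, $X_i$ takes values in a countable set $D_i$ with probability distribution $\mathcal D_i$; $\mathcal D=\prod_i\mathcal D_i$ is the product distribution. $\Phi=\phi_1\wedge\cdots\wedge\phi_m$, where clause $\phi_k$ is a Boolean function of the variables with indices in its nonempty scope $\mathrm{Scp}(\phi_k)\subseteq[n]$. A dependency relation is a symmetric relation $\sim$ on pairs of distinct elements of $[m]$ such that $k\sim\ell$ implies $\mathrm{Scp}(\phi_k)\cap\mathrm{Scp}(\phi_\ell)\ne\emptyset$. The converse need not hold. Axiom 1: if $k\sim\ell$, then $\phi_k\vee\phi_\ell$ is true under every assignment. Axiom 2: let $k\ne\ell$ with $k\not\sim\ell$, let $\mathbf x$ be an assignment under which both $\phi_k$ and $\phi_\ell$ are false, and let $\mathbf x'$ be any assignment agreeing with $\mathbf x$ outside $\mathrm{Scp}(\phi_\ell)$. Then there is some $k'\in[m]$ with $\mathrm{Scp}(\phi_{k'})\supseteq\mathrm{Scp}(\phi_k)$ and $\phi_{k'}$ false under $\mathbf x'$. Algorithm $\mathrm{PRS}_f(\Phi,\mathcal D)$: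 fix a function $f$ that assigns to each nonempty $N\subseteq[m]$ an element $f(N)\in N$. Sample $\mathbf X$ from $\mathcal D$. While $\Phi(\mathbf X)$ is false, let $N=\{\ell:\phi_\ell\text{ is false under the current }\mathbf X\}$, let $k=f(N)$, and resample all $X_i$, $i\in\mathrm{Scp}(\phi_k)$, independently from $\mathcal D_i$. *)

(* Defs.v *)
From HB Require Import structures.
From mathcomp Require Import all_boot all_order all_algebra.
From mathcomp Require Import all_classical all_reals all_analysis.
Unset Printing Implicit Defensive.
Import Order.TTheory GRing.Theory Num.Theory.
Local Open Scope ring_scope.

Definition assignment {n : nat} (T : 'I_n -> countType) : countType :=
  {dffun forall i : 'I_n, T i}.

Section PRS.
Variables (R : realType) (n m : nat) (T : 'I_n -> countType).
Variable (D : forall i : 'I_n, T i -> R).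
Variable (scp : 'I_m -> {set 'I_n}).
Variable (phi : 'I_m -> assignment T -> bool).
Variable (f : {set 'I_m} -> 'I_m).

Definition is_distribution (i : 'I_n) : Prop :=
  (forall t, 0 <= D i t) /\ (\esum_(t in [set: T i]) (D i t)%:E = 1%E).

Definition prodD (x : assignment T) : R := \prod_(i < n) D i (x i).

Definition depends_only_on_scope : Prop :=
  forall k (x y : assignment T),
    (forall i, i \in scp k -> x i = y i) -> phi k x = phi k y.

Definition Phi (x : assignment T) : bool := [forall k, phi k x].

Definition PrPhi : \bar R := \esum_(x in [set x | Phi x]) (prodD x)%:E.

Definition dependency_relation (dep : rel 'I_m) : Prop :=
  [/\ forall k l, dep k l = dep l k,
      forall k, ~~ dep k k &
      forall k l, dep k l -> scp k :&: scp l != finset.set0].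

Definition axiom1 (dep : rel 'I_m) : Prop :=
  forall k l, dep k l -> forall x : assignment T, phi k x || phi l x.

Definition axiom2 (dep : rel 'I_m) : Prop :=
  forall k l, k != l -> ~~ dep k l ->
  forall x x' : assignment T, ~~ phi k x -> ~~ phi l x ->
    (forall i, i \notin scp l -> x' i = x i) ->
    exists k', (scp k \subset scp k') && ~~ phi k' x'.

Definition choice_function : Prop :=
  forall N : {set 'I_m}, N != finset.set0 -> f N \in N.

Definition false_clauses (x : assignment T) : {set 'I_m} :=
  [set k | ~~ phi k x].

Definition resample (S : {set 'I_n}) (x y : assignment T) : R :=
  if `[< forall i, i \notin S -> y i = x i >] then \prod_(i in S) D i (y i)
  else 0.

(* law of the state X after t iterations of PRS_f(Phi, D); once Phi holds
   the algorithm has stopped and X stays fixed. *)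
Fixpoint prs_law (t : nat) (y : assignment T) : \bar R :=
  match t with
  | 0 => (prodD y)%:E
  | t'.+1 =>
      (if Phi y then prs_law t' y else 0%E) +
      \esum_(x in [set x | ~~ Phi x])
         (prs_law t' x * (resample (scp (f (false_clauses x))) x y)%:E)%E
  end.

End PRS.

Arguments is_distribution {R n T} D i.
Arguments prodD {R n T} D x.
Arguments depends_only_on_scope {n m T} scp phi.
Arguments Phi {n m T} phi x.
Arguments PrPhi {R n m T} D phi.
Arguments dependency_relation {n m} scp dep.
Arguments axiom1 {n m T} phi dep.
Arguments axiom2 {n m T} scp phi dep.
Arguments choice_function {m} f.
Arguments false_clauses {n m T} phi x.
Arguments resample {R n T} D S x y.
Arguments prs_law {R n m T} D scp phi f t y.

(* Main.v *)
Require Import Defs.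
From HB Require Import structures.
From mathcomp Require Import all_boot all_order all_algebra.
From mathcomp Require Import all_classical all_reals all_analysis.
From mathcomp Require Import ring lra.
Import Order.TTheory GRing.Theory Num.Theory.
Local Open Scope ring_scope.
Local Open Scope classical_set_scope.

(* The law [L] of the state after any number of steps satisfies, on satisfying
   assignments [z], [z'], the relation [L z * D z' = L z' * D z].  By induction on
   the number of steps one proves a stronger statement: if [z] and [z'] agree on a
   set [S] containing the scopes of their false clauses, then [L z] and [L z'] are
   in the ratio of the weights of [z] and [z'] outside [S].  For the step, a
   predecessor [x] of [z], where clause [l] was resampled, is matched with the
   predecessor [x'] of [z'] equal to [x] on [S :|: scp l] and to [z'] elsewhere.
   By the two axioms every clause false at [x] or [x'] has its scope inside
   [S :|: scp l], so [x] and [x'] have the same false clauses and the same clause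
   is chosen.

   Termination does not involve the axioms: fix a satisfying [y0] of positive
   probability [p].  With probability at least [p] the resampled variables take
   their values in [y0], and this decreases the Hamming distance to [y0].  Hence
   [2 - (p / 2) ^+ distance], set to 0 on satisfying assignments, decays
   geometrically in expectation. *)

(** * Sums of nonnegative extended reals: scaling, restriction, exchange, bijections *)

Section ExtendedSums.
Set Implicit Arguments.
Unset Strict Implicit.
Context {R : realType} {I J : choiceType}.
Local Open Scope ereal_scope.

Lemma esumZl (P : set I) (c : R) (a : I -> \bar R) :
  (0 <= c)%R -> (forall i, 0 <= a i) ->
  \esum_(i in P) (c%:E * a i) = c%:E * \esum_(i in P) a i.
Proof.
move=> c_ge0 a_ge0; rewrite /esum -ereal_supZl//; last first.
  apply/set0P; exists 0; exists set0; first exact: fsets_set0.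
  by rewrite fsbig_set0.
congr ereal_sup; apply/seteqP; split.
  move=> _ [X PX <-]; exists (\sum_(i \in X) a i); first by exists X.
  by rewrite ge0_mule_fsumr.
by move=> _ [_ [X PX <-] <-]; exists X; rewrite ?ge0_mule_fsumr.
Qed.

Lemma esum_subset_eq (P Q : set I) (a : I -> \bar R) :
  P `<=` Q -> (forall i, Q i -> ~ P i -> a i = 0) ->
  \esum_(i in Q) a i = \esum_(i in P) a i.
Proof.
move=> PQ a0; rewrite [LHS]esum_mkcond [RHS]esum_mkcond; apply: eq_esum => i _.
case: (boolP (i \in Q)) => [/set_mem Qi|]; case: (boolP (i \in P)) => //.
  by move/negP; rewrite inE => /(a0 _ Qi).
by move=> /set_mem/PQ Qi; rewrite mem_set.
Qed.

Lemma exchange_esum (P : set I) (Q : set J) (a : I -> J -> \bar R) :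
  (forall i j, 0 <= a i j) ->
  \esum_(i in P) \esum_(j in Q) a i j = \esum_(j in Q) \esum_(i in P) a i j.
Proof.
move=> a_ge0; rewrite !esum_esum//.
rewrite (@reindex_esum _ _ _ (Q `*`` fun=> P) _ (fun p => (p.2, p.1)))//.
split=> [[j i] []//|[j i] [j' i'] _ _ [-> ->]//|[i j] [Pi Qj]].
by exists (j, i).
Qed.

Lemma set_bij_inv (P : set I) (Q : set J) (e : I -> J) (e' : J -> I) :
  (forall x, P x -> Q (e x) /\ e' (e x) = x) ->
  (forall y, Q y -> P (e' y) /\ e (e' y) = y) -> set_bij P Q e.
Proof.
move=> He He'; split=> [x /He[]//|x y /set_mem/He[_ eK] /set_mem/He[_ eK'] exy|y Qy].
  by rewrite -eK exy eK'.
by exists (e' y); have [] := He' y Qy.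
Qed.

End ExtendedSums.

(** * Product weights, and resampling as a probability kernel *)

Section Assignments.
Set Implicit Arguments.
Unset Strict Implicit.
Context {R : realType} {n : nat} {T : 'I_n -> countType}.
Variable D : forall i : 'I_n, T i -> R.
Hypothesis D_distr : forall i, is_distribution D i.
Implicit Types (S : {set 'I_n}) (x y z : assignment T).

Definition splice S x y : assignment T :=
  [ffun i => if i \in S then x i else y i].

Definition update x i (t : T i) : assignment T := [ffun j => dfwith x i t j].

Definition weight S x : R := \prod_(i in S) D (x i).

Lemma D_ge0 (i : 'I_n) (t : T i) : 0 <= D t :> R.
Proof. by have [/(_ t)] := D_distr i. Qed.

Lemma D_le1 (i : 'I_n) (t : T i) : D t <= 1 :> R.
Proof.
have [_ D1] := D_distr i; rewrite -lee_fin -D1.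
apply: esum_ge; exists [set t]; first by split => //; exact: finite_set1.
by rewrite fsbig_set1.
Qed.

Lemma weight_ge0 S x : 0 <= weight S x.
Proof. by apply: prodr_ge0 => i _; exact: D_ge0. Qed.

Lemma weight0 x : weight finset.set0 x = 1.
Proof. exact: big_set0. Qed.

Lemma weightT x : weight [set: 'I_n]%SET x = prodD D x.
Proof. by rewrite /weight /prodD; apply: eq_bigl => i; rewrite inE. Qed.

Lemma weightID S S' x :
  weight S x = weight (S :&: S')%SET x * weight (S :\: S')%SET x.
Proof. by rewrite /weight (big_setID S'). Qed.

Lemma eq_weight S x y : (forall i, i \in S -> x i = y i) -> weight S x = weight S y.
Proof. by move=> xy; apply: eq_bigr => i /xy ->. Qed.

Lemma prodD_le_weight S x : prodD D x <= weight S x.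
Proof.
rewrite -weightT (weightID _ S) finset.setTI ler_piMr ?weight_ge0//.
by apply: prodr_ile1 => i _; rewrite D_ge0 D_le1.
Qed.

Lemma resample_on S x y : (forall i, i \notin S -> y i = x i) ->
  resample D S x y = weight S y.
Proof. by move=> yx; rewrite /resample; case: asboolP. Qed.

Lemma resample_off S x y : ~ (forall i, i \notin S -> y i = x i) ->
  resample D S x y = 0.
Proof. by move=> yx; rewrite /resample; case: asboolP. Qed.

Lemma resample_ge0 S x y : 0 <= resample D S x y.
Proof. by rewrite /resample; case: asboolP => // _; exact: weight_ge0. Qed.

Lemma resampleT x y : resample D [set: 'I_n]%SET x y = prodD D y.
Proof. by rewrite resample_on ?weightT// => i; rewrite inE. Qed.

(** Only [t = y i] contributes, since resampling [S] leaves coordinate [i] untouched. *)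
Lemma resampleU1 S i x y : i \notin S ->
  (resample D (i |: S)%SET x y)%:E =
  (\esum_(t in [set: T i]) ((D t)%:E * (resample D S (update x t) y)%:E))%E.
Proof.
move=> iS; rewrite (@esum_subset_eq _ _ [set y i])//; last first.
  move=> t _ /= tyi; rewrite resample_off ?mule0// => /(_ i iS).
  by rewrite ffunE dfwithin => /esym.
rewrite esum_set1; last by rewrite mule_ge0 ?lee_fin ?D_ge0 ?resample_ge0.
rewrite -EFinM; congr EFin.
have [yx|Nyx] := pselect (forall j, j \notin (i |: S)%SET -> y j = x j).
  rewrite !resample_on// /weight ?big_setU1//= => j.
  rewrite ffunE; case: dfwithP => // k ik kS.
  by apply: yx; rewrite !inE negb_or eq_sym ik.
rewrite !resample_off ?mulr0// => yx; apply: Nyx => j.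
by rewrite !inE negb_or => /andP[ij /yx ->]; rewrite ffunE dfwithout// eq_sym.
Qed.

(** Induction on the number of resampled variables, peeled off one at a time by [resampleU1]. The
    start [x] stays general because peeling replaces it by [update x t]. *)
Lemma esum_resample S x :
  (\esum_(y in [set: assignment T]) (resample D S x y)%:E = 1)%E.
Proof.
elim: {S}#|S| {-2}S (erefl #|S|) x => [|k IHk] S.
  move=> /cards0_eq -> x; rewrite (@esum_subset_eq _ _ [set x])//; last first.
    move=> y _ /= yx; rewrite resample_off// => H; apply: yx.
    by apply/ffunP => i; apply: H; rewrite inE.
  by rewrite esum_set1 ?lee_fin ?resample_ge0// resample_on// weight0.
move=> Sk x.
have /card_gt0P[i iS] : (0 < #|S|)%N by rewrite Sk.
rewrite -(finset.setD1K iS).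
under eq_esum => y _ do rewrite resampleU1 ?finset.setD11//.
rewrite exchange_esum; last first.
  by move=> y t; rewrite mule_ge0 ?lee_fin ?D_ge0 ?resample_ge0.
have [_ <-] := D_distr i; apply: eq_esum => t _.
rewrite esumZl ?D_ge0//; last by move=> y; rewrite lee_fin resample_ge0.
rewrite IHk ?mule1//.
by apply/eqP; rewrite -(eqn_add2l 1) -[X in (X + _)%N]/(nat_of_bool true) -iS -cardsD1 Sk.
Qed.

End Assignments.

(** * False clauses, and the law of the state *)

Section Algorithm.
Set Implicit Arguments.
Unset Strict Implicit.
Context {R : realType} {n m : nat} {T : 'I_n -> countType}.
Variables (D : forall i : 'I_n, T i -> R) (scp : 'I_m -> {set 'I_n}).
Variables (phi : 'I_m -> assignment T -> bool) (f : {set 'I_m} -> 'I_m).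
Hypothesis D_distr : forall i, is_distribution (@D) i.
Hypothesis phi_scp : depends_only_on_scope scp phi.
Hypothesis f_choice : choice_function f.
Implicit Types (S : {set 'I_n}) (x y z : assignment T).

Notation law := (prs_law (@D) scp phi f).
Notation bad := (false_clauses phi).
Notation scp_next x := (scp (f (bad x))).

Let weight0_le := weight_ge0 D_distr.
Let resample0 := resample_ge0 D_distr.

Lemma in_false_clauses x k : (k \in bad x) = ~~ phi k x.
Proof. by rewrite inE. Qed.

Lemma Phi_false_clauses x : Phi phi x = (bad x == finset.set0).
Proof.
apply/forallP/eqP => [Hx|x0 k].
  by apply/setP => k; rewrite in_false_clauses Hx inE.
by apply/negPn; rewrite -in_false_clauses x0 inE.
Qed.

Lemma false_next x : ~~ Phi phi x -> f (bad x) \in bad x.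
Proof. by rewrite Phi_false_clauses => /f_choice. Qed.

Lemma false_clauses_sub S x y : (forall k, k \in bad x -> scp k \subset S) ->
  (forall i, i \in S -> x i = y i) -> bad x \subset bad y.
Proof.
move=> xS xy; apply/fintype.subsetP => k kx; rewrite in_false_clauses.
rewrite -(phi_scp (x := x)) -?in_false_clauses// => i ik.
by rewrite xy//; apply: (fintype.subsetP (xS _ kx)).
Qed.

Lemma law_ge0 t y : (0 <= law t y)%E.
Proof.
elim: t y => [y|t IHt y] /=; first by rewrite lee_fin -weightT weight0_le.
apply: adde_ge0; first by case: ifP.
by apply: esum_ge0 => x _; rewrite mule_ge0 ?lee_fin ?resample0.
Qed.

(** * Invariance of the ratio, by a bijection between predecessors *)

Section Invariance.
Variable dep : rel 'I_m.
Hypothesis ax1 : axiom1 phi dep.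
Hypothesis ax2 : axiom2 scp phi dep.

(** For [k] distinct from [l], both clauses fail at [x], so Axiom 1 rules out [dep k l]. Axiom 2
    then yields a clause false at [y] whose scope contains that of [k]; that scope lies in [S]. *)
Lemma scp_false_before S l x y : l \in bad x ->
  (forall i, i \notin scp l -> y i = x i) ->
  (forall k, k \in bad y -> scp k \subset S) ->
  forall k, k \in bad x -> scp k \subset S :|: scp l.
Proof.
move=> lx yx yS k kx; have [->|kl] := eqVneq k l; first exact: finset.subsetUr.
move: lx kx; rewrite !in_false_clauses => lx kx.
have Ndep : ~~ dep k l.
  by apply/negP => /ax1 /(_ x); rewrite (negbTE lx) (negbTE kx).
have [k' /andP[kk' k'y]] := ax2 kl Ndep kx lx yx.
apply: fintype.subset_trans kk' (fintype.subset_trans _ (finset.subsetUl _ _)).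
by apply: yS; rewrite in_false_clauses.
Qed.

Definition coupled S z z' :=
  [/\ forall i, i \in S -> z i = z' i,
      forall k, k \in bad z -> scp k \subset S
    & forall k, k \in bad z' -> scp k \subset S].

Lemma coupled_sym S z z' : coupled S z z' -> coupled S z' z.
Proof. by case=> zz' zS z'S; split=> // i /zz'. Qed.

Lemma coupled_false_clauses S z z' : coupled S z z' -> bad z = bad z'.
Proof.
case=> zz' zS z'S; apply/eqP; rewrite finset.eqEsubset.
by rewrite !(@false_clauses_sub S)// => i /zz'.
Qed.

Definition couple S z' x := splice (S :|: scp_next x)%SET x z'.

Definition predecessor z x :=
  ~~ Phi phi x /\ (forall i, i \notin scp_next x -> z i = x i).

(** Used in both directions, this makes [couple S z'] a bijection with inverse [couple S z]. The
    enlarged coupling is what the induction hypothesis takes. *)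
Lemma coupled_couple S z z' x : coupled S z z' -> predecessor z x ->
  [/\ coupled (S :|: scp_next x)%SET x (couple S z' x),
      predecessor z' (couple S z' x) & couple S z (couple S z' x) = x].
Proof.
move=> [zz' zS z'S] [Nx zx]; set x' := couple S z' x.
set l := f (bad x) in zx *; set S1 := (S :|: scp l)%SET.
have lx : l \in bad x := false_next Nx.
have xx' i : i \in S1 -> x i = x' i by rewrite ffunE => ->.
have xS1 := scp_false_before lx zx zS.
have xx's := false_clauses_sub xS1 xx'.
have z'x' i : i \notin scp l -> z' i = x' i.
  move=> il; rewrite ffunE !inE (negbTE il) orbF.
  by case: ifPn => // iS; rewrite -zz'// zx.
(* By [xx's], clause [l] is also false at [x'], so the axioms apply to the transition from [x'] to
   [z'] as well. *)
have x'S1 := scp_false_before (fintype.subsetP xx's _ lx) z'x' z'S.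
have cxx' : coupled S1 x x' by [].
have bxx' := coupled_false_clauses cxx'.
split=> //; first by split; [rewrite Phi_false_clauses -bxx' -Phi_false_clauses|rewrite -bxx'].
apply/ffunP => i; rewrite ffunE -bxx' -/l; case: ifPn => [/xx'//|].
by rewrite !inE negb_or => /andP[_ /zx].
Qed.

(** The ratio is cross-multiplied because weights may vanish. [S] is quantified in the induction: it
    becomes [S :|: scp l] at the predecessors. *)
Lemma law_invariant t S z z' : coupled S z z' ->
  (law t z * (weight D (~: S)%SET z')%:E = law t z' * (weight D (~: S)%SET z)%:E)%E.
Proof.
elim: t S z z' => [|t IHt] S z z' czz'.
  rewrite /= -!EFinM; congr EFin; rewrite -!weightT !(weightID _ finset.setT S).
  rewrite !finset.setTI !finset.setTD (@eq_weight _ _ _ D S z z'); first by ring.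
  by case: czz'.
have bzz' := coupled_false_clauses czz'.
rewrite /= !ge0_muleDl; try by [case: ifP|case: ifP => // _; exact: law_ge0|
  apply: esum_ge0 => x _; rewrite mule_ge0 ?law_ge0 ?lee_fin ?resample0].
(* Having the same false clauses, [z] and [z'] are either both satisfying or both not, so the
   stopped terms match by induction. *)
rewrite !(Phi_false_clauses z) !(Phi_false_clauses z') -bzz'; congr adde.
  by case: ifP => _; [exact: IHt|rewrite !mul0e].
have sumZ y c : 0 <= c ->
    ((\esum_(x in [set x | ~~ Phi phi x])
       (law t x * (resample D (scp_next x) x y)%:E)) * c%:E =
    \esum_(x in predecessor y)
      (c%:E * (law t x * (resample D (scp_next x) x y)%:E)))%E.
  move=> c_ge0; rewrite muleC -esumZl//; last first.
    by move=> x; rewrite mule_ge0 ?law_ge0 ?lee_fin ?resample0.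
  apply: esum_subset_eq => [x []//|x /= Nx xy].
  by rewrite resample_off ?mule0// => yx; apply: xy; split.
rewrite (sumZ z _ (weight0_le _ z')) (sumZ z' _ (weight0_le _ z)).
rewrite (@reindex_esum _ _ _ (predecessor z) (predecessor z') (couple S z')); last first.
  apply: (@set_bij_inv _ _ _ _ _ (couple S z)) => x.
    by move=> /(coupled_couple czz')[].
  by move=> /(coupled_couple (coupled_sym czz'))[].
apply: eq_esum => x Px.
have [cxx' [Nx' z'x'] _] := coupled_couple czz' Px.
have bxx' := coupled_false_clauses cxx'.
have IH := IHt _ _ _ cxx'.
case: Px => Nx zx; rewrite !resample_on//.
move: z'x' IH; rewrite -bxx'; set l := f (bad x) in zx *; set x' := couple S z' x => z'x' IH.
set S1 := (S :|: scp l)%SET in IH *.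
have offS1 i : i \in (~: S1)%SET -> i \notin scp l by rewrite !inE negb_or => /andP[].
have D1 : (~: S :\: scp l)%SET = (~: S1)%SET by rewrite finset.setDE -finset.setCU.
have D2 : (scp l :\: S)%SET = (~: S :&: scp l)%SET by rewrite finset.setIC -finset.setDE.
(* The factor common to both sides: the weight on [scp l] inside [S], where [z] and [z'] agree, and
   outside [S] the weights of both. *)
set c := weight D (scp l :&: S)%SET z * weight D (~: S :&: scp l)%SET z *
  weight D (~: S :&: scp l)%SET z'.
have e1 : weight D (~: S)%SET z' * weight D (scp l) z = weight D (~: S1)%SET x' * c.
  rewrite (weightID _ (~: S)%SET (scp l)) (weightID _ (scp l) S) D1 D2.
  rewrite (@eq_weight _ _ _ D _ x' z'); first by rewrite /c; ring.
  by move=> i /offS1/z'x'.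
have e2 : weight D (~: S)%SET z * weight D (scp l) z' = weight D (~: S1)%SET x * c.
  rewrite (weightID _ (~: S)%SET (scp l)) (weightID _ (scp l) S) D1 D2.
  rewrite (@eq_weight _ _ _ D _ x z); last by move=> i /offS1/zx.
  rewrite (@eq_weight _ _ _ D (scp l :&: S)%SET z' z); first by rewrite /c; ring.
  by case: czz' => zz' _ _ i; rewrite inE => /andP[_ /zz'].
rewrite ![(law t _ * _)%E]muleC !muleA -!EFinM e1 e2.
by rewrite ![(_%:E * law t _)%E]muleC !EFinM !muleA IH.
Qed.

(** Without false clauses, [z] and [z'] are coupled over the empty set, whose complement carries the
    full weight. *)
Lemma law_Phi t z z' : Phi phi z -> Phi phi z' ->
  (law t z * (prodD (@D) z')%:E = law t z' * (prodD (@D) z)%:E)%E.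
Proof.
move=> Pz Pz'; rewrite -!weightT -finset.setC0; apply: law_invariant.
move: Pz Pz'; rewrite !Phi_false_clauses => /eqP Pz /eqP Pz'.
by split=> [i|k|k]; rewrite ?Pz ?Pz' inE.
Qed.

End Invariance.

(** Finiteness of the law is a hypothesis because it comes from the total mass, which is itself
    computed with this lemma for [V = 1]. *)
Lemma law_step t (V : assignment T -> R) :
  (forall x, law t x \is a fin_num) -> (forall x, 0 <= V x) ->
  (\esum_(y in setT) (law t.+1 y * (V y)%:E) =
   \esum_(y in [set y | Phi phi y]) (law t y * (V y)%:E) +
   \esum_(x in [set x | ~~ Phi phi x])
     (law t x * \esum_(y in setT) (resample D (scp_next x) x y * V y)%:E))%E.
Proof.
move=> law_fin V0.
have lawM0 x r : 0 <= r -> (0 <= law t x * r%:E)%E.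
  by move=> r0; rewrite mule_ge0 ?law_ge0.
have rV0 x y : 0 <= resample D (scp_next x) x y * V y.
  by rewrite mulr_ge0 ?resample0.
transitivity (\esum_(y in setT) ((if Phi phi y then law t y * (V y)%:E else 0) +
    \esum_(x in [set x | ~~ Phi phi x])
      (law t x * (resample D (scp_next x) x y * V y)%:E)))%E.
  apply: eq_esum => y _ /=; rewrite ge0_muleDl; last 2 first.
  - by case: ifP => // _; exact: law_ge0.
  - by apply: esum_ge0 => x _; exact: lawM0 (resample0 _ _ _).
  congr adde; first by case: ifP; rewrite // mul0e.
  rewrite muleC -esumZl//; last by move=> x; exact: lawM0 (resample0 _ _ _).
  by apply: eq_esum => x _; rewrite EFinM muleC muleA.
rewrite esumD; last 2 first.
- by move=> y _; case: ifP => // _; exact: lawM0.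
- by move=> y _; apply: esum_ge0 => x _; exact: lawM0.
congr adde.
  rewrite (@esum_subset_eq _ _ [set y | Phi phi y])//; last by move=> y _ /= /negP/negbTE ->.
  by apply: eq_esum => y /= ->.
rewrite exchange_esum; last by move=> y x; exact: lawM0.
apply: eq_esum => x _; rewrite -(fineK (law_fin x)) esumZl//.
  by rewrite fine_ge0 ?law_ge0.
by move=> y; rewrite lee_fin.
Qed.

(** Sampling amounts to resampling every variable, from an arbitrary start [x0]. *)
Lemma esum_prodD (x0 : assignment T) :
  (\esum_(y in setT) (prodD (@D) y)%:E = 1)%E.
Proof.
rewrite -(esum_resample D_distr [set: 'I_n]%SET x0).
by apply: eq_esum => y _; rewrite resampleT.
Qed.

Lemma le1_fin_num (a : \bar R) : (0 <= a)%E -> (a <= 1)%E -> a \is a fin_num.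
Proof. by move=> a0 a1; rewrite ge0_fin_numE// (le_lt_trans a1) ?ltry. Qed.

Lemma law_total (x0 : assignment T) t : (\esum_(y in setT) law t y = 1)%E.
Proof.
elim: t => [|t IHt]; first exact: esum_prodD.
have law_fin x : law t x \is a fin_num.
  apply: le1_fin_num; first exact: law_ge0.
  rewrite -IHt; apply: esum_ge; exists [set x]; first by split => //; exact: finite_set1.
  by rewrite fsbig_set1.
transitivity (\esum_(y in setT) (law t.+1 y * (1 : R)%:E))%E.
  by apply: eq_esum => y _; rewrite mule1.
rewrite (law_step law_fin)//.
rewrite -[RHS]IHt [RHS](esumID [set y | Phi phi y]); last by move=> *; exact: law_ge0.
rewrite !setTI; congr adde; first by apply: eq_esum => y _; rewrite mule1.
have -> : [set x | ~~ Phi phi x] = ~` [set y | Phi phi y].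
  by apply/seteqP; split => x /= /negP.
apply: eq_esum => x _; under eq_esum => y _ do rewrite mulr1.
by rewrite esum_resample// mule1.
Qed.

Lemma law_fin_num (x0 : assignment T) t x : law t x \is a fin_num.
Proof.
apply: le1_fin_num; first exact: law_ge0.
rewrite -(law_total x0 t); apply: esum_ge.
by exists [set x]; [split => //; exact: finite_set1|rewrite fsbig_set1].
Qed.

(** * Geometric decay of the expected potential *)

Section Termination.
Variable y0 : assignment T.
Hypothesis Phi_y0 : Phi phi y0.
Hypothesis y0_gt0 : 0 < prodD (@D) y0.

Let p := prodD (@D) y0.
(** With this halving, [p * a ^+ d = 2 * a ^+ d.+1]: the gain from moving one closer to [y0] is
    twice the current deficit below 2. *)
Let a := p / 2.

Definition distance x := #|[set i | x i != y0 i]%SET|.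

Definition potential x : R := if Phi phi x then 0 else 2 - a ^+ distance x.

Let p_le1 : p <= 1.
Proof. by rewrite /p -(weight0 D y0) prodD_le_weight. Qed.

Let a_gt0 : 0 < a. Proof. by rewrite divr_gt0. Qed.

Let a_le1 : a <= 1. Proof. by have := p_le1; rewrite /a; lra. Qed.

Let aX_ge0 k : 0 <= a ^+ k. Proof. exact/exprn_ge0/ltW. Qed.

Let aX_le1 k : a ^+ k <= 1. Proof. by apply: exprn_ile1 => //; exact: ltW. Qed.

Lemma potential_ge0 x : 0 <= potential x.
Proof. by rewrite /potential; case: ifP => // _; have := aX_le1 (distance x); lra. Qed.

Lemma potential_ge1 x : ~~ Phi phi x -> 1 <= potential x.
Proof. by rewrite /potential => /negbTE ->; have := aX_le1 (distance x); lra. Qed.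

Lemma potential_le2 x : potential x <= 2 - a ^+ distance x.
Proof. by rewrite /potential; case: ifP => // _; have := aX_le1 (distance x); lra. Qed.

(* [y0] satisfies the clause being resampled, so [x] and [y0] differ on its scope. *)
Lemma distance_splice x : ~~ Phi phi x ->
  (distance (splice (scp_next x) y0 x) < distance x)%N.
Proof.
move=> Nx; have := false_next Nx; set l := f _; rewrite in_false_clauses => lx.
have [i il xi] : exists2 i, i \in scp l & x i != y0 i.
  apply: contrapT => xy0; move/negP: lx; apply.
  rewrite (phi_scp (y := y0)) ?(forallP Phi_y0)// => i il.
  by apply/eqP/negPn/negP => xi; apply: xy0; exists i.
apply: proper_card; apply/properP; split.
  apply/fintype.subsetP => j; rewrite !inE ffunE.
  by case: ifP => // _; rewrite eqxx.
by exists i; rewrite !inE// ffunE il eqxx.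
Qed.

Lemma potential_drift x : ~~ Phi phi x ->
  (\esum_(y in setT) (resample D (scp_next x) x y * potential y)%:E
    <= ((1 - a ^+ n / 2) * potential x)%:E)%E.
Proof.
move=> Nx; set S := scp_next x; set y1 := splice S y0 x.
set q := p * a ^+ distance y1.
have q_ge0 : 0 <= q by rewrite mulr_ge0// ltW.
have rV0 y : 0 <= resample D S x y * potential y.
  by rewrite mulr_ge0 ?resample0 ?potential_ge0.
have r1 : p <= resample D S x y1.
  rewrite resample_on; last by move=> i iS; rewrite ffunE (negbTE iS).
  by rewrite (@eq_weight _ _ _ _ _ _ y0) ?prodD_le_weight// => i iS; rewrite ffunE iS.
(* The potential is at most 2 everywhere, and at [y1], reached with probability at least [p], it is
   lower by at least [a ^+ distance y1]; this saves [q]. *)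
have sum_le2 : (\esum_(y in setT) (resample D S x y * potential y)%:E + q%:E <= 2%:E)%E.
  have -> : q%:E = (\esum_(y in [set: assignment T]) (if y == y1 then q else 0)%:E)%E.
    rewrite (@esum_subset_eq _ _ [set y1])//; last by move=> y _ /= /eqP/negbTE ->.
    by rewrite esum_set1 ?eqxx ?lee_fin.
  rewrite -esumD; last 2 first.
  - by move=> y _; rewrite lee_fin.
  - by move=> y _; rewrite lee_fin; case: ifP.
  rewrite -[leRHS]mule1 -(esum_resample D_distr S x) -esumZl//; last first.
    by move=> y; rewrite lee_fin resample0.
  apply: le_esum => y _; rewrite -EFinD -EFinM lee_fin.
  have := resample0 S x y; have := potential_le2 y; have := aX_ge0 (distance y).
  case: eqP => [->|_]; last by nra.
  by rewrite /q; have := potential_ge0 y1; nra.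
have q_lb : 2 * a ^+ distance x <= q.
  have -> : q = 2 * a ^+ (distance y1).+1 by rewrite exprS /q /a; field.
  rewrite ler_pM2l// ler_wiXn2l// ?distance_splice//.
  by rewrite ltW.
apply: (@le_trans _ _ (2 - q)%:E); first by rewrite EFinB leeBrDr.
(* The drop is at least [a ^+ distance x], hence at least [a ^+ n]; since the potential is at most
   2, this is a fraction at least [a ^+ n / 2] of it. *)
rewrite lee_fin /potential (negbTE Nx).
have anx : a ^+ n <= a ^+ distance x.
  rewrite ler_wiXn2l//; first exact: ltW.
  by rewrite -[leqRHS]card_ord max_card.
have := aX_ge0 (distance x); have := aX_ge0 n; nra.
Qed.

Lemma expected_potential t :
  (\esum_(y in setT) (law t y * (potential y)%:E)
    <= (2 * (1 - a ^+ n / 2) ^+ t)%:E)%E.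
Proof.
set c := 1 - a ^+ n / 2.
have c_ge0 : 0 <= c by rewrite /c; have := aX_le1 n; lra.
elim: t => [|t IHt].
  rewrite expr0 mulr1 -[leRHS]mule1 -(esum_prodD y0) -esumZl//; last first.
    by move=> y; rewrite lee_fin -weightT weight0_le.
  apply: le_esum => y _; rewrite /= muleC lee_wpmul2r//.
    by rewrite lee_fin -weightT weight0_le.
  by rewrite lee_fin (le_trans (potential_le2 y))// gerBl.
rewrite (law_step (law_fin_num y0 t) potential_ge0) esum1 ?add0e; last first.
  by move=> y; rewrite /potential /= => ->; rewrite mule0.
apply: (@le_trans _ _ (c%:E * \esum_(y in setT) (law t y * (potential y)%:E))%E).
  rewrite -esumZl//; last by move=> y; rewrite mule_ge0 ?law_ge0 ?lee_fin ?potential_ge0.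
  rewrite [leRHS](@esum_subset_eq _ _ [set x | ~~ Phi phi x])//; last first.
    by move=> y _ /= /negP/negPn; rewrite /potential => ->; rewrite !mule0.
  apply: le_esum => x /= Nx; rewrite muleCA -EFinM.
  by rewrite lee_wpmul2l ?law_ge0 ?potential_drift.
by rewrite exprS mulrCA EFinM lee_wpmul2l.
Qed.

(** The potential is at least 1 on unsatisfying assignments, so its expectation bounds the mass that
    has not stopped. *)
Lemma law_Phi_cvg :
  (\esum_(y in [set y | Phi phi y]) law t y)%E @[t --> \oo] --> 1%E.
Proof.
set c := 1 - a ^+ n / 2.
have c_lt1 : `|c| < 1.
  rewrite ger0_norm /c; have := aX_le1 n; have := exprn_gt0 n a_gt0; lra.
apply: (@squeeze_cvge _ _ _ _ (fun t => (1 - geometric 2 c t)%:E) _ (fun=> 1%E)).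
- near=> t; have tot := law_total y0 t.
  rewrite (esumID [set y | Phi phi y]) in tot; last by move=> *; exact: law_ge0.
  rewrite !setTI in tot.
  have Phi0 : (0 <= \esum_(y in [set y | Phi phi y]) law t y)%E.
    by apply: esum_ge0 => y _; exact: law_ge0.
  have N0 : (0 <= \esum_(y in ~` [set y | Phi phi y]) law t y)%E.
    by apply: esum_ge0 => y _; exact: law_ge0.
  apply/andP; split; last by rewrite -tot leeDl.
  rewrite EFinB leeBlDr// -tot leeD2l// (le_trans _ (expected_potential t))//.
  rewrite [leRHS](@esum_subset_eq _ _ (~` [set y | Phi phi y]))//; last first.
    by move=> y _ /= /contrapT; rewrite /potential => ->; rewrite mule0.
  apply: le_esum => y /negP Ny; rewrite -[leLHS]mule1 lee_wpmul2l ?law_ge0//.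
  by rewrite lee_fin potential_ge1.
- apply: cvg_EFin; first by near=> t.
  rewrite -[X in _ --> X]subr0; apply: cvgB; first exact: cvg_cst.
  exact: cvg_geometric.
- exact: cvg_cst.
Unshelve. all: by end_near. Qed.

End Termination.

End Algorithm.

Theorem theorem5 (R : realType) (n m : nat) (T : 'I_n -> countType)
    (D : forall i : 'I_n, T i -> R)
    (scp : 'I_m -> {set 'I_n})
    (phi : 'I_m -> assignment T -> bool)
    (dep : rel 'I_m)
    (f : {set 'I_m} -> 'I_m) :
  (forall i, is_distribution D i) ->
  (forall k, scp k != finset.set0) ->
  depends_only_on_scope scp phi ->
  (0 < PrPhi D phi)%E ->
  dependency_relation scp dep ->
  axiom1 phi dep ->
  axiom2 scp phi dep ->
  choice_function f ->
  (* termination with probability 1 *)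
  (\esum_(y in [set y | Phi phi y]) prs_law D scp phi f t y)%E @[t --> \oo]
     --> 1%E
  /\
  (* on termination, X is distributed according to D conditioned on Phi *)
  (forall y : assignment T, Phi phi y ->
     prs_law D scp phi f t y @[t --> \oo]
       --> ((prodD D y) / fine (PrPhi D phi))%:E).
Proof.
move=> D_distr _ phi_scp PrPhi_gt0 _ ax1 ax2 f_choice.
have D0 x : 0 <= prodD D x by rewrite -weightT weight_ge0.
have [y0 Phi_y0 y0_gt0] : exists2 y0, Phi phi y0 & 0 < prodD D y0.
  apply: contrapT => no_y0; move: PrPhi_gt0; rewrite /PrPhi esum1 ?ltxx// => x /= Px.
  congr EFin; apply/eqP; rewrite eq_le D0 andbT leNgt.
  by apply/negP => x_gt0; apply: no_y0; exists x.
have PrPhi_fin : PrPhi D phi \is a fin_num.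
  apply: le1_fin_num; first exact: ltW.
  rewrite -(esum_prodD D_distr y0) (esumID [set x | Phi phi x] setT); last first.
    by move=> x _; rewrite lee_fin.
  by rewrite setTI leeDl// esum_ge0// => x _; rewrite lee_fin.
have cvg1 := law_Phi_cvg D_distr phi_scp f_choice Phi_y0 y0_gt0.
split=> // y Phi_y.
rewrite -[X in _ --> X]mul1e.
(* The conditional law is exact at every [t]: the mass at [y] is the stopped mass times its
   conditional probability. Only the stopped mass needs a limit. *)
suff -> : (fun t => prs_law D scp phi f t y) =
    (fun t => (\esum_(z in [set z | Phi phi z]) prs_law D scp phi f t z) *
              (prodD D y / fine (PrPhi D phi))%:E)%E.
  exact: cvgeZr.
apply/funext => t.
have lawy_fin := law_fin_num scp phi f D_distr y0 t y.
have law0 := law_ge0 scp phi f D_distr t.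
(* This is [law_Phi] summed over all satisfying [z]. *)
have lawPr : (prs_law D scp phi f t y * PrPhi D phi =
    (prodD D y)%:E * \esum_(z in [set z | Phi phi z]) prs_law D scp phi f t z)%E.
  have fine_law0 := fine_ge0 (law0 y).
  rewrite -(fineK lawy_fin) /PrPhi -esumZl//.
  rewrite -esumZl//.
  apply: eq_esum => z Phi_z; rewrite (fineK lawy_fin) muleC [RHS]muleC.
  by rewrite muleC (law_Phi D_distr phi_scp f_choice ax1 ax2).
rewrite /= EFinM muleA [X in (X * _)%E]muleC -lawPr -{1}(fineK PrPhi_fin).
rewrite -muleA -EFinM divff ?mule1//.
by rewrite gt_eqF// fine_gt0// PrPhi_gt0 -ge0_fin_numE// ltW.
Qed.
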